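(* For any integer $n\geq 1$ and any composition $L$ of $n$, there exists exactly one permutation $\pi\in\mathfrak{S}_n$ with descent composition $L$ such that $\operatorname{ipk}(\pi)=0$.
   Context: $\mathfrak{S}_n$ is the set of permutations of $[n]=\{1,2,\dots,n\}$, written in one-line notation $\pi=\pi_1\pi_2\cdots\pi_n$. A composition of $n$ is a finite sequence of positive integers with sum $n$. The increasing runs of $\pi$ are its maximal increasing consecutive subsequences. The descent composition of $\pi$ is the composition of $n$ whose parts are the lengths of the increasing runs of $\pi$ in the order in which they appear; for example, $85712643$ has descent composition $(1,2,3,1,1)$. An index $i\in\{2,\dots,n-1\}$ is a peak of $\pi\in\mathfrak{S}_n$ if $\pi_{i-1}<\pi_i>\pi_{i+1}$. $\operatorname{ipk}(\pi)$ denotes the number of peaks of the inverse permutation $\pi^{-1}$. *)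

(* Defs.v *)
From mathcomp Require Import all_boot all_fingroup.

Set Implicit Arguments.
Unset Strict Implicit.
Unset Printing Implicit Defensive.

Definition is_composition (n : nat) (L : seq nat) : bool :=
  all (fun k => 0 < k) L && (sumn L == n).

(* Elements of 'S_n permute {0, ..., n-1}; the letters are shifted by one so
   that the word is over {1, ..., n}. *)
Definition one_line (n : nat) (s : 'S_n) : seq nat :=
  [seq (s i).+1 | i <- enum 'I_n].

(* The head letter x extends the first run of the tail when it is smaller than
   the first letter of that run, and otherwise is a run by itself; the catch-all
   branch is only reached when the tail is empty, since all runs are nonempty. *)
Fixpoint incr_runs (w : seq nat) : seq (seq nat) :=
  if w is x :: w' then
    match incr_runs w' with
    | (y :: r) :: rs =>
        if x < y then (x :: y :: r) :: rs else [:: x] :: (y :: r) :: rs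
    | _ => [:: [:: x]]
    end
  else [::].

Example incr_runs_ex :
  shape (incr_runs [:: 8; 5; 7; 1; 2; 6; 4; 3]) = [:: 1; 2; 3; 1; 1].
Proof. by []. Qed.

Lemma incr_runs_nonempty w : all (fun r => r != [::]) (incr_runs w).
Proof.
elim: w => //= x w; case: (incr_runs w) => [|[|y r] rs] //= Hrs.
by case: ifP.
Qed.

Lemma flatten_incr_runs w : flatten (incr_runs w) = w.
Proof.
elim: w => //= x w; have := incr_runs_nonempty w.
case: (incr_runs w) => [|[|y r] rs] //= _; first by move=> <-.
by case: ifP => _ /= ->.
Qed.

Lemma incr_runs_sorted w : all (sorted ltn) (incr_runs w).
Proof.
elim: w => //= x w; case: (incr_runs w) => [|[|y r] rs] //= /andP[Hr Hrs].
by case: ifP => /= [-> | _]; rewrite Hr.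
Qed.

(* Maximality: two consecutive runs cannot be merged. *)
Lemma incr_runs_maximal w :
  sorted (fun r1 r2 => head 0 r2 <= last 0 r1) (incr_runs w).
Proof.
elim: w => //= x w; case: (incr_runs w) => [|[|y r] rs] //= Hrs.
by case: ltnP => /= [_ | ->]; case: rs Hrs.
Qed.

Definition descent_composition (n : nat) (s : 'S_n) : seq nat :=
  shape (incr_runs (one_line s)).

(* Requiring both neighbours j = i - 1 and k = i + 1 to exist in 'I_n excludes
   the two end positions. *)
Definition is_peak (n : nat) (s : 'S_n) (i : 'I_n) : bool :=
  [exists j : 'I_n, exists k : 'I_n,
    [&& j.+1 == i :> nat, i.+1 == k :> nat, s j < s i & s k < s i]].

Definition pk (n : nat) (s : 'S_n) : nat := #|[set i | is_peak s i]|.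

Definition ipk (n : nat) (s : 'S_n) : nat := pk (s^-1)%g.

(* Main.v *)
Require Import Defs.
From mathcomp Require Import all_boot all_fingroup.
From mathcomp Require Import zify.

Set Implicit Arguments.
Unset Strict Implicit.
Unset Printing Implicit Defensive.

(** For a permutation s of {0, ..., n-1}, the inverse of s has no peak exactly
    when every letter of s is a left-to-right maximum or a left-to-right
    minimum.  Indeed, if s k lies strictly between two earlier letters s i and
    s j, then on the interval of values from s i to s j the inverse of s is
    larger at the inner point s k than at both ends, so its maximum there is an
    inner point, that is, a peak; conversely the three values around a peak
    form such a pattern ([ipk0P]).

    So for the permutations in question the truth of s k < s j, for j < k, does
    not depend on j; taking j = k - 1, it says that a run starts at position k,
    which the descent composition determines.  Hence the two conditions on s
    amount to prescribing all the inversions of s: for j < k, the pair (j, k)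
    is an inversion iff k is the start of a run of L
    ([descent_composition_ipk0P]).

    A permutation is determined by its inversions, because s i is the number of
    j with s j < s i.  This gives uniqueness, and evaluating this number for the
    prescribed inversions gives an explicit candidate ([letter]), which
    satisfies the prescription. *)

(** * Runs and descents of words *)

(** A composition is encoded by the indicator sequence of the first positions
    of its blocks, which can be compared position by position with the descents
    of a word. *)
Definition run_starts (L : seq nat) : seq bool :=
  flatten [seq true :: nseq l.-1 false | l <- L].

Lemma size_run_starts L :
  all (fun l => 0 < l) L -> size (run_starts L) = sumn L.
Proof.
elim: L => //= l L IH /andP[l_gt0 /IH sizeL].
by rewrite size_cat size_nseq sizeL -addSn prednK.
Qed.

(** The first block is recovered as the distance to the next [true]. *)
Lemma run_starts_inj :
  {in all (fun l => 0 < l) &, injective run_starts}.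
Proof.
have findE m L : find id (nseq m false ++ run_starts L) = m.
  rewrite find_cat has_nseq andbF size_nseq.
  by case: L => [|l L] /=; rewrite addn0.
elim=> [|l L IH] [|l' L'] //= /andP[l_gt0 posL] /andP[l'_gt0 posL'] [eqLL'].
have eq_l : l.-1 = l'.-1 by rewrite -(findE l.-1 L) eqLL' findE.
move: eqLL'; rewrite eq_l => /eqP; rewrite eqseq_cat // eqxx /= => /eqP eqL.
by rewrite (IH L') // -(prednK l_gt0) eq_l prednK.
Qed.

Lemma incr_runs_cons x w :
  exists r rs, incr_runs (x :: w) = (x :: r) :: rs.
Proof.
move=> /=; case: (incr_runs w) => [|[|y r] rs]; try by exists [::], [::].
by case: ifP => _; [exists (y :: r), rs | exists [::], ((y :: r) :: rs)].
Qed.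

Lemma run_starts_incr_runs x w :
  run_starts (shape (incr_runs (x :: w)))
  = true :: pairmap (fun a b => b <= a) x w.
Proof.
elim: w x => [//|y w IH] x.
have [r [rs runs_yw]] := incr_runs_cons y w.
have -> : incr_runs [:: x, y & w]
        = if x < y then (x :: y :: r) :: rs else [:: x] :: (y :: r) :: rs.
  by move: runs_yw; move: (y :: w) => v /= ->.
have := IH y; rewrite runs_yw [pairmap _ x _]/= (leqNgt y x) => -[bits_yw].
by case: (x < y); rewrite /run_starts /= bits_yw.
Qed.

Lemma shape_incr_runs_gt0 w : all (fun l => 0 < l) (shape (incr_runs w)).
Proof.
rewrite all_map; apply: sub_all (incr_runs_nonempty w) => r /=.
by rewrite -size_eq0 lt0n.
Qed.

Lemma nth_run_starts_incr_runs w i : i.+1 < size w ->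
  nth false (run_starts (shape (incr_runs w))) i.+1
  = (nth 0 w i.+1 <= nth 0 w i).
Proof.
case: w => // x w lt_i; rewrite run_starts_incr_runs /=.
by rewrite (nth_pairmap 0).
Qed.

Lemma shape_incr_runsP w L : is_composition (size w) L ->
  shape (incr_runs w) = L <->
  forall i, i.+1 < size w ->
    nth false (run_starts L) i.+1 = (nth 0 w i.+1 <= nth 0 w i).
Proof.
move=> /andP[posL /eqP sumL]; split=> [<- i|bitsL].
  exact: nth_run_starts_incr_runs.
have pos_w := shape_incr_runs_gt0 w.
have size_w : sumn (shape (incr_runs w)) = size w.
  by rewrite -size_flatten flatten_incr_runs.
apply: run_starts_inj => //; apply: (@eq_from_nth _ false).
  by rewrite !size_run_starts // size_w.
rewrite size_run_starts // size_w => -[w_gt0|i lt_i]; last first.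
  by rewrite bitsL // nth_run_starts_incr_runs.
(* At position 0 both sequences start with [true]. *)
by case: w L {pos_w posL size_w bitsL} w_gt0 sumL => [|x w] [|l L] //;
  rewrite run_starts_incr_runs.
Qed.

Lemma nth_one_line n (s : 'S_n) (i : 'I_n) : nth 0 (one_line s) i = (s i).+1.
Proof. by rewrite (nth_map i) ?size_enum_ord // nth_ord_enum. Qed.

Lemma descent_compositionP n (s : 'S_n) L : is_composition n L ->
  descent_composition s = L <->
  forall j k : 'I_n, k = j.+1 :> nat ->
    (s k < s j) = nth false (run_starts L) k.
Proof.
move=> compL; have size_s : size (one_line s) = n.
  by rewrite size_map size_enum_ord.
have neq_s (j k : 'I_n) : k = j.+1 :> nat -> (s k <= s j) = (s k < s j).
  move=> kE; rewrite [RHS]ltn_neqAle (inj_eq val_inj) (inj_eq perm_inj).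
  by rewrite -(inj_eq val_inj) /= kE gtn_eqF.
rewrite /descent_composition shape_incr_runsP size_s //; split=> bitsL.
  move=> j k kE; rewrite kE bitsL -kE //.
  by rewrite !nth_one_line ltnS neq_s.
move=> i lt_i; have := nth_one_line s (Ordinal lt_i).
have := nth_one_line s (Ordinal (ltnW lt_i)) => /= -> ->.
by rewrite ltnS neq_s // bitsL.
Qed.

(** * Permutations whose inverse has no peak *)

(** An inner maximum over an interval of positions is a peak, as a permutation
    takes no value twice. *)
Lemma pk0_quasiconvex n (t : 'S_n) (a b c : 'I_n) :
  pk t = 0 -> a < b < c -> t a < t b -> t b < t c.
Proof.
move=> /eqP; rewrite cards_eq0 => /eqP no_peak /andP[lt_ab lt_bc] lt_tab.
rewrite ltnNge; apply/negP => le_tcb.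
have b_in : a <= b <= c by rewrite (ltnW lt_ab) (ltnW lt_bc).
have [m /andP[le_am le_mc] m_max] :=
  @arg_maxnP _ b (fun i : 'I_n => a <= i <= c) (fun i => t i) b_in.
have max_m (i : 'I_n) : a <= i <= c -> t i <= t m by move/m_max.
have ne_t (i j : 'I_n) : i != j -> t i != t j :> nat.
  by rewrite (inj_eq val_inj) (inj_eq perm_inj).
have lt_tcb : t c < t b.
  by rewrite ltn_neqAle le_tcb ne_t // -(inj_eq val_inj) gtn_eqF.
have le_tbm := max_m b b_in.
have ne_am : a != m by apply: contraTneq le_tbm => <-; rewrite -ltnNge.
have ne_mc : m != c by apply: contraTneq le_tbm => ->; rewrite -ltnNge.
have lt_am : a < m by rewrite ltn_neqAle le_am (inj_eq val_inj) ne_am.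
have lt_mc : m < c by rewrite ltn_neqAle le_mc (inj_eq val_inj) ne_mc.
have lt_pm : m.-1 < n by apply: leq_ltn_trans (leq_pred m) (ltn_ord m).
have lt_sm : m.+1 < n by apply: leq_ltn_trans lt_mc (ltn_ord c).
have : m \in [set i | is_peak t i]; last by rewrite no_peak inE.
rewrite inE; apply/existsP; exists (Ordinal lt_pm).
apply/existsP; exists (Ordinal lt_sm) => /=.
rewrite prednK ?(leq_ltn_trans _ lt_am) // !eqxx /=.
apply/andP; split; rewrite ltn_neqAle max_m /= ?andbT; try lia.
all: by apply: ne_t; rewrite -(inj_eq val_inj) /=; lia.
Qed.

(** The inverse has a peak iff the value of some letter lies strictly between
    the values of two earlier letters: directly from a peak to such a
    letter, and by quasi-convexity of the inverse the other way. *)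
Lemma ipk0P n (s : 'S_n) :
  ipk s = 0 <->
  forall i j k : 'I_n, i < k -> j < k -> (s k < s i) = (s k < s j).
Proof.
split=> [no_peak i j k|one_sided].
  (* The contradiction is reached at s^-1, for the values s i < s k < s j. *)
  have between (i' j' : 'I_n) : i' < k -> j' < k -> s k < s j' -> s k < s i'.
    move=> lt_i lt_j lt_kj; rewrite ltnNge leq_eqVlt; apply/negP => /orP[].
      rewrite (inj_eq val_inj) (inj_eq perm_inj) => /eqP eq_ik.
      by rewrite eq_ik ltnn in lt_i.
    move=> lt_ik; have := @pk0_quasiconvex n s^-1%g (s i') (s k) (s j') no_peak.
    rewrite lt_ik lt_kj !permK => /(_ isT lt_i) lt_kj'.
    by have := ltn_trans lt_j lt_kj'; rewrite ltnn.
  by move=> lt_i lt_j; apply/idP/idP; apply: between.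
apply/eqP; rewrite cards_eq0; apply/eqP/setP => v; rewrite !inE.
apply/negbTE/negP => /existsP[u] /existsP[w].
move=> /and4P[/eqP uE /eqP wE lt_u lt_w].
have := one_sided _ _ _ lt_u lt_w; rewrite !permKV; lia.
Qed.

(** Without peaks in the inverse, the comparison of s k with any earlier letter
    is the comparison with its left neighbour, which the run starts give. *)
Lemma descent_composition_ipk0P n (s : 'S_n) L : is_composition n L ->
  descent_composition s = L /\ ipk s = 0 <->
  forall j k : 'I_n, j < k -> (s k < s j) = nth false (run_starts L) k.
Proof.
move=> compL; rewrite descent_compositionP // ipk0P; split.
  move=> [bitsL one_sided] j k lt_jk.
  have lt_pk : k.-1 < n by apply: leq_ltn_trans (leq_pred k) (ltn_ord k).
  have pkK : k.-1.+1 = k by rewrite prednK // (leq_ltn_trans _ lt_jk).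
  rewrite (one_sided j (Ordinal lt_pk)) //=; first exact: bitsL.
  by rewrite -[X in _ < X]pkK.
move=> bitsL; split=> [j k kE|i j k lt_ik lt_jk]; last by rewrite !bitsL.
by apply: bitsL; rewrite kE.
Qed.

(** * Permutations and their inversions *)

Lemma perm_rank n (s : 'S_n) (i : 'I_n) : s i = #|[set j | s j < s i]| :> nat.
Proof.
rewrite -(card_imset _ (@perm_inj _ s)).
have -> : [set s j | j in [set j | s j < s i]] = [set k : 'I_n | k < s i].
  apply/setP => k; rewrite !inE; apply/imsetP/idP => [[j]|lt_k].
    by rewrite inE => lt_j ->.
  by exists ((s^-1)%g k); rewrite ?inE permKV.
rewrite -sum1_card; under eq_bigl do rewrite inE.
rewrite (big_ord_narrow (ltnW (ltn_ord (s i)))) /=.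
by rewrite sum1_card card_ord.
Qed.

Lemma inversions_inj n (s t : 'S_n) :
  (forall j k : 'I_n, j < k -> (s k < s j) = (t k < t j)) -> s = t.
Proof.
move=> eq_inv; apply/permP => i; apply/val_inj.
rewrite /= (perm_rank s i) (perm_rank t i).
apply: eq_card => j; rewrite !inE.
have gtE (u : 'S_n) (x y : 'I_n) : x < y -> (u x < u y) = ~~ (u y < u x).
  move=> lt_xy; rewrite -leqNgt [LHS]ltn_neqAle (inj_eq val_inj).
  by rewrite (inj_eq perm_inj) -(inj_eq val_inj) /= ltn_eqF.
case: (ltngtP i j) => [|lt_ji|/val_inj ->]; first exact: eq_inv.
  by rewrite (gtE s _ _ lt_ji) (gtE t _ _ lt_ji) eq_inv.
by rewrite !ltnn.
Qed.

(** The number of letters that have to be smaller than the letter at position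
    [k]: all [k] earlier ones unless [b k] holds, and the later ones at the
    positions marked by [b]. *)
Definition letter (n : nat) (b : nat -> bool) (k : nat) : nat :=
  (~~ b k) * k + \sum_(k.+1 <= j < n) b j.

Lemma sum_bool_le (b : nat -> bool) m n : \sum_(m <= j < n) b j <= n - m.
Proof.
rewrite -[leqRHS]muln1 -sum_nat_const_nat.
by apply: leq_sum => j _; apply: leq_b1.
Qed.

Lemma letter_ltn n b k : k < n -> letter n b k < n.
Proof.
move=> lt_kn; have := sum_bool_le b k.+1 n.
by rewrite /letter; case: (b k) => /=; lia.
Qed.

(** The marked positions after [j] and after [k] differ by those in the
    half-open interval from [j], excluded, to [k], included.  If [k] is marked
    it contributes to the letter at [j] and this decides the comparison;
    otherwise at most [k - j - 1] positions contribute, fewer than the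
    difference between the first summands. *)
Lemma letter_inversion n b j k :
  j < k < n ->
  (letter n b k < letter n b j) = b k /\ letter n b k != letter n b j.
Proof.
move=> /andP[lt_jk lt_kn]; rewrite /letter.
rewrite (@big_cat_nat _ _ _ k.+1 j.+1 n) //=; last exact: leqW.
rewrite (big_nat_recr k j.+1) //=.
have := sum_bool_le b j.+1 k; set S := \sum_(j.+1 <= _ < k) _.
set T := \sum_(k.+1 <= _ < n) _ => le_S.
by case: (b k); case: (b j) => /=; split; lia.
Qed.

Lemma exists_perm_inversions n (b : nat -> bool) :
  exists s : 'S_n, forall j k : 'I_n, j < k -> (s k < s j) = b k.
Proof.
pose f (k : 'I_n) : 'I_n := Ordinal (letter_ltn b (ltn_ord k)).
have invf (j k : 'I_n) : j < k -> (f k < f j) = b k /\ f k != f j :> nat.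
  by move=> lt_jk; apply: letter_inversion; rewrite lt_jk ltn_ord.
have f_inj : injective f.
  move=> j k eq_f; apply/val_inj => /=.
  by case: (ltngtP j k) => // /invf[_]; rewrite eq_f eqxx.
by exists (perm f_inj) => j k /invf[invjk _]; rewrite !permE.
Qed.

Theorem theorem5 (n : nat) (L : seq nat) (hn : 1 <= n)
    (hL : is_composition n L) :
  exists! s : 'S_n, descent_composition s = L /\ ipk s = 0.
Proof.
have [s invs] := exists_perm_inversions n (nth false (run_starts L)).
exists s; split; first exact/descent_composition_ipk0P.
move=> t /(descent_composition_ipk0P _ hL) invt.
by apply: inversions_inj => j k lt_jk; rewrite invs ?invt.
Qed.
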